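(* Let $\rho>0$, $k\ge1$, $n\ge1$, and suppose that an $n$-tuple $X=(x_1,\dots,x_n)$ of self-adjoint operators in a tracial $W^*$-probability space $(\mathcal{M},\tau)$ admits higher-order free Stein kernels $A_1,\dots,A_k$ up to order $k$ with respect to the potential $V_\rho$. Then $\tau(P(X))=\tau(P(S_\rho))$ for every noncommutative polynomial $P$ in $n$ variables of degree $l\le k$, where $S_\rho=(S_\rho^1,\dots,S_\rho^n)$ is a free $(0,\rho^{-1})$-semicircular $n$-tuple. Moreover, if the relation also holds for noncommutative polynomials of degree $k+1$, these kernels are centered: for any choice of $i_1,\dots,i_{k+1}\in\{1,\dots,n\}$, $$\tau^{\otimes(k+1)}\big((A_k)_{i_1,\dots,i_{k+1}}\big)=0.$$
   Context: $\mathbb{P}=\mathbb{C}\langle t_1,\dots,t_n\rangle$ is the $*$-algebra of noncommutative polynomials in $n$ self-adjoint variables. $V_\rho=\frac{\rho}{2}\sum_{j=1}^nt_j^2$, with cyclic gradient $\mathcal{D}V_\rho=(\rho t_1,\dots,\rho t_n)$. A free $(0,\rho^{-1})$-semicircular $n$-tuple consists of $n$ free semicircular variables of mean $0$ and variance $\rho^{-1}$. The free difference quotients $\partial_j:\mathbb{P}\to\mathbb{P}\otimes\mathbb{P}^{op}$ are defined on monomials by $\partial_jm=\sum_{m=at_jb}a\otimes b$. For $P=(p_1,\dots,p_n)\in\mathbb{P}^n$: $\mathcal{J}P=(\partial_jp_i)_{i,j}$ and $\mathcal{J}^kP=\{\partial^k_{(i_1,\dots,i_k)}p_j\}_{j,i_1,\dots,i_k=1}^n$,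 where $\partial^k_{(i_1,\dots,i_k)}=(\partial_{i_1}\otimes id^{\otimes(k-1)})\circ(\partial_{i_2}\otimes id^{\otimes(k-2)})\circ\cdots\circ\partial_{i_k}$; these are evaluated at $X$ in each tensor factor. $\mathbb{T}_{(k+1,n)}(\mathcal{M}^{\otimes(k+1)})$ denotes arrays with $k+1$ indices in $\{1,\dots,n\}$ and entries in $\mathcal{M}^{\otimes(k+1)}$, with $L^2$ inner product $\langle A,B\rangle_2=\sum\tau^{\otimes(k+1)}(a_{j,i_1,\dots,i_k}b_{j,i_1,\dots,i_k}^* )$ (sum over all indices). Also $\langle X,Y\rangle_\tau=\sum_j\tau(y_j^*x_j)$. A free Stein kernel of order $k$ for $X$ with respect to $V_\rho$ is an element $A_k\in L^2(\mathbb{T}_{(k+1,n)}(\mathcal{M}^{\otimes(k+1)}))$ such that for every $P\in\mathbb{P}^n$ $$\langle[\mathcal{D}V_\rho](X),P(X)\rangle_\tau-(\tau\otimes\tau)\circ Tr\big(([\mathcal{J}P](X))^*\big)=\langle A_k,[\mathcal{J}^kP](X)\rangle_2 .$$ *)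

(* Defs.v *)
From HB Require Import structures.
From mathcomp Require Import all_boot all_order all_algebra.
From mathcomp Require Import finmap.
From mathcomp Require Import all_classical all_reals all_analysis.
From mathcomp Require Import complex.
(* Without its notations, which clash with those of mathcomp-analysis:
   [malg K G] is the type of finitely supported functions K -> G. *)
From mathcomp Require Import -(notations) monalg.

Set Implicit Arguments.
Unset Strict Implicit.
Unset Printing Implicit Defensive.

Import Order.TTheory GRing.Theory Num.Theory.
Import numFieldNormedType.Exports.
Local Open Scope classical_set_scope.
Local Open Scope ring_scope.
Local Open Scope complex_scope.

(* The inner product is linear on the left and antilinear on the right. *)
Record hilbert (R : realType) := Hilbert {
  hilbert_space :> completeNormedModType R[i];
  inner : {dot hilbert_space for @Num.conj R[i]};
  inner_norm : forall u : hilbert_space, `|u| ^+ 2 = inner u u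
}.

Definition commuting (R : realType) (H : hilbert R) (S T : {linear H -> H}) :=
  forall u, S (T u) = T (S u).

(* A unital *-algebra with a faithful unital *-representation by bounded
   operators whose image is its own bicommutant. *)
Record wstar (R : realType) := WStar {
  wstar_alg :> algType R[i];
  star : wstar_alg -> wstar_alg;
  wstar_hilbert : hilbert R;
  rep : wstar_alg -> {linear wstar_hilbert -> wstar_hilbert};
  rep_continuous : forall x, continuous (rep x);
  rep_linear : forall (c : R[i]) x y u,
    rep (c *: x + y) u = c *: rep x u + rep y u;
  rep1 : forall u, rep 1 u = u;
  repM : forall x y u, rep (x * y) u = rep x (rep y u);
  rep_star : forall x u v,
    inner wstar_hilbert (rep x u) v = inner wstar_hilbert u (rep (star x) v);
  rep_inj : forall x y, (forall u, rep x u = rep y u) -> x = y;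
  rep_bicommutant : forall T : {linear wstar_hilbert -> wstar_hilbert},
    continuous T ->
    (forall S : {linear wstar_hilbert -> wstar_hilbert}, continuous S ->
       (forall x, commuting S (rep x)) -> commuting T S) ->
    exists x, forall u, rep x u = T u
}.

Definition selfadjoint (R : realType) (M : wstar R) (x : M) := star x = x.

Definition wle (R : realType) (M : wstar R) (x y : M) :=
  exists z : M, y - x = star z * z.

(* Least upper bound in the ordered set of self-adjoint elements. *)
Definition is_sup (R : realType) (M : wstar R) (D : set M) (s : M) :=
  [/\ selfadjoint s, (forall x, D x -> wle x s) &
      forall y, selfadjoint y -> (forall x, D x -> wle x y) -> wle s y].

(* Normality of a positive functional: it preserves suprema of upward directed
   families of self-adjoint elements (the inequality f x <= f s for x in D
   being automatic). *)
Definition normal (R : realType) (M : wstar R) (f : M -> R[i]) :=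
  forall (D : set M) (s : M),
    D !=set0 -> (forall x, D x -> selfadjoint x) ->
    (forall x y, D x -> D y -> exists z, [/\ D z, wle x z & wle y z]) ->
    is_sup D s ->
    forall b : R[i], (forall x, D x -> f x <= b) -> f s <= b.

Record tracial_wstar (R : realType) := TracialWStar {
  tracial_alg :> wstar R;
  tau : {scalar tracial_alg};
  tau1 : tau 1 = 1;
  tau_ge0 : forall x, 0 <= tau (star x * x);
  tau_faithful : forall x, tau (star x * x) = 0 -> x = 0;
  tau_trace : forall x y, tau (x * y) = tau (y * x);
  tau_normal : normal tau
}.

Definition ncpoly (R : realType) (n : nat) := malg (fmonom 'I_n) R[i].

(* The m-th tensor power of [ncpoly R n], with the m-tuples of words as basis.
   Only its linear structure is used, so that the opposite product on tensor
   factors plays no role. *)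
Definition nctens (R : realType) (n m : nat) :=
  malg (m.-tuple (fmonom 'I_n)) R[i].

Section LinearExtension.
Context (R : realType) (K : choiceType).

Definition basis (k : K) : malg K R[i] := mkmalgU k 1.

Definition linext (V : lmodType R[i]) (f : K -> V) (g : malg K R[i]) : V :=
  \sum_(k <- msupp g) mcoeff k g *: f k.

Definition semilinext (V : lmodType R[i]) (f : K -> V) (g : malg K R[i]) : V :=
  \sum_(k <- msupp g) (mcoeff k g)^* *: f k.

End LinearExtension.

Section NCPoly.
Context (R : realType) (n : nat).
Implicit Types (i j : 'I_n) (P : ncpoly R n).

Definition ncvar j : ncpoly R n := basis R (FMonom [:: j]).

Definition ncdeg P : nat := \max_(w <- msupp P) size w.

(* All pairs (a, b) such that w = a t_j b. *)
Definition splits j (w : seq 'I_n) : seq (fmonom 'I_n * fmonom 'I_n) :=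
  [seq (FMonom (take p w), FMonom (drop p.+1 w)) |
     p <- iota 0 (size w) & onth w p == Some j].

Definition tens1 P : nctens R n 1 :=
  linext (fun w => basis R [tuple w]) P.

(* [fdq_head j] is the free difference quotient with respect to t_j on the
   first tensor factor, tensored with the identity on the other ones. *)
Definition fdq_head m j (T : nctens R n m.+1) : nctens R n m.+2 :=
  linext (fun w : m.+1.-tuple (fmonom 'I_n) =>
    \sum_(s <- splits j (thead w))
      basis R [tuple of s.1 :: s.2 :: behead w]) T.

Definition fdq j P : nctens R n 2 := fdq_head j (tens1 P).

(* The leftmost index is the last one to be differentiated. *)
Fixpoint fdq_iter k : k.-tuple 'I_n -> ncpoly R n -> nctens R n k.+1 :=
  match k with
  | 0 => fun _ P => tens1 P
  | k'.+1 => fun t P => fdq_head (thead t) (fdq_iter (behead_tuple t) P)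
  end.

Definition jacobian (P : 'I_n -> ncpoly R n) : 'M[nctens R n 2]_n :=
  \matrix_(i, j) fdq j (P i).

(* The index tuple is (j, i_1, ..., i_k), j being the component of P. *)
Definition jacobian_iter k (P : 'I_n -> ncpoly R n) (t : k.+1.-tuple 'I_n) :
    nctens R n k.+1 :=
  fdq_iter (behead_tuple t) (P (thead t)).

Definition cyclic_gradient P j : ncpoly R n :=
  linext (fun w : fmonom 'I_n =>
    \sum_(s <- splits j w) basis R (FMonom (s.2 ++ s.1))) P.

Definition quadratic_potential (rho : R) : ncpoly R n :=
  (rho / 2)%:C *: \sum_(j < n) ncvar j ^+ 2.

Definition word_eval (A : algType R[i]) (X : 'I_n -> A) (w : fmonom 'I_n) : A :=
  \prod_(i <- (w : seq 'I_n)) X i.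

Definition nceval (A : algType R[i]) (X : 'I_n -> A) (P : ncpoly R n) : A :=
  linext (word_eval X) P.

End NCPoly.

Section Tensor.
Context (R : realType) (M : tracial_wstar R).

(* Formal linear combinations of elementary tensors a_1 (x) ... (x) a_m. They
   represent the elements of the algebraic tensor power; the multilinearity
   relations are not divided out, since [tens_star], [tens_tau] and the map
   into the L^2 space below all respect them. *)
Definition tens (m : nat) := malg (m.-tuple M) R[i].

Definition tens_star m (T : tens m) : tens m :=
  semilinext (fun a : m.-tuple M => basis R (map_tuple (@star R M) a)) T.

Definition tens_tau m (T : tens m) : R[i] :=
  \sum_(a <- msupp T) mcoeff a T * \prod_(i < m) tau M (tnth a i).

Definition tens_eval n (X : 'I_n -> M) m (T : nctens R n m) : tens m :=
  linext (fun w : m.-tuple (fmonom 'I_n) =>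
    basis R (map_tuple (word_eval X) w)) T.

(* The completion of the m-th tensor power of M for the inner product
   <a, b> = tau^(x)m (a b^* ), determined up to a unique unitary operator. *)
Record tensL2 (m : nat) := TensL2 {
  l2_space :> hilbert R;
  l2_pure : m.-tuple M -> l2_space;
  l2_inner : forall a b,
    inner l2_space (l2_pure a) (l2_pure b) =
    \prod_(i < m) tau M (tnth a i * star (tnth b i));
  l2_dense : dense (range (linext l2_pure))
}.

Definition l2_of m (L : tensL2 m) (T : tens m) : L := linext (@l2_pure m L) T.

(* The extension of tau^(x)m to L^2, i.e. A |-> <A, 1 (x) ... (x) 1>. *)
Definition l2_tau m (L : tensL2 m) (A : L) : R[i] :=
  inner L A (l2_pure L (nseq_tuple m 1)).

Section Stein.
Context (n : nat).

Definition tuple_inner (X Y : 'I_n -> M) : R[i] :=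
  \sum_(j < n) tau M (star (Y j) * X j).

Definition mx_star (B : 'M[tens 2]_n) : 'M[tens 2]_n :=
  \matrix_(i, j) tens_star (B j i).

Definition array_inner k (L : tensL2 k.+1)
    (A : k.+1.-tuple 'I_n -> L) (B : k.+1.-tuple 'I_n -> tens k.+1) : R[i] :=
  \sum_(t : k.+1.-tuple 'I_n) inner L (A t) (l2_of L (B t)).

Definition stein_kernel (V : ncpoly R n) (X : 'I_n -> M) k (L : tensL2 k.+1)
    (A : k.+1.-tuple 'I_n -> L) :=
  forall P : 'I_n -> ncpoly R n,
    tuple_inner (fun j => nceval X (cyclic_gradient V j))
                (fun j => nceval X (P j))
    - tens_tau (\tr (mx_star (map_mx (tens_eval X (m := 2)) (jacobian P))))
    = array_inner A (fun t => tens_eval X (jacobian_iter P t)).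

End Stein.
End Tensor.

Section Semicircular.
Context (R : realType) (N : tracial_wstar R).

Definition semicircle_moment (v : R) (m : nat) : R :=
  \int[lebesgue_measure]_(x in `[- (2 * Num.sqrt v), 2 * Num.sqrt v])
    (x ^+ m * ((2 * pi * v)^-1 * Num.sqrt (4 * v - x ^+ 2))).

(* Semicircular of mean 0 and variance v. *)
Definition semicircular (v : R) (s : N) :=
  selfadjoint s /\ forall m, tau N (s ^+ m) = (semicircle_moment v m)%:C.

(* Freeness of the unital algebras generated by the s_i. *)
Definition free_family (n : nat) (s : 'I_n -> N) :=
  forall a : seq ('I_n * {poly R[i]}),
    a != [::] -> sorted (fun p q => p.1 != q.1) a ->
    (forall p, p \in a -> tau N (horner_alg (s p.1) p.2) = 0) ->
    tau N (\prod_(p <- a) horner_alg (s p.1) p.2) = 0.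

Definition free_semicircular (v : R) (n : nat) (s : 'I_n -> N) :=
  (forall i, semicircular v (s i)) /\ free_family s.

End Semicircular.

(* Main.v *)
Require Import Defs.
From HB Require Import structures.
From mathcomp Require Import all_boot all_order all_algebra.
From mathcomp Require Import finmap.
From mathcomp Require Import all_classical all_reals all_analysis.
From mathcomp Require Import complex ring.
From mathcomp Require Import -(notations) monalg.

Set Implicit Arguments.
Unset Strict Implicit.
Unset Printing Implicit Defensive.

Import Order.TTheory GRing.Theory Num.Theory.
Import numFieldNormedType.Exports.
Local Open Scope ring_scope.

(** The kernel equation tested against an array of polynomials of degree less
    than the order j of the kernel has a zero right-hand side, because the j-th
    iterated difference quotients vanish. What remains is the Schwinger-Dyson
    equation of the quadratic potential,
      rho tau(w x_i) = sum over w = a x_i b of tau(a) tau(b),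
    valid for all words w of length less than k. It expresses a moment of
    length l + 1 through moments of length less than l, so together with
    tau(1) = 1 it determines all moments up to length k ([word_moments]). A
    free semicircular family satisfies the same equations for all words, hence
    has the same moments.

    Both tuples are compared with an explicit solution of these equations, the
    vacuum expectation on the full Fock space, where the i-th variable acts as
    creation plus rho^-1 times annihilation of the letter i. [vacuum_coef w u]
    is the coefficient of the vacuum in the image of the basis vector e_u under
    the word w. The equations hold because a letter that has been created must
    be annihilated by a later occurrence of the same letter
    ([vacuum_coef_rcons]).

    On the free side the basis vector e_u corresponds to a product of Chebyshev
    polynomials, one for each maximal block of equal letters of u
    ([cheb_word]). The three-term recurrence of these polynomials is the
    action of the variables on the e_u ([mul_cheb_word]), and freeness says that
    the trace of such a product is zero unless u is empty ([tau_cheb_word]). The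
    factors are centered because of the one-variable moments: integration by
    parts gives a two-term recursion for the moments of the semicircle law,
    which implies the convolution recursion of the Catalan numbers ([segner]),
    and that is the vacuum recursion for a single letter.

    Finally, the j-th iterated difference quotient of a word of length j is
    the unit tensor for exactly one index and zero for the others
    ([fdq_iter_word]). Testing the kernel equation against that word therefore
    expresses the mean of an entry of the kernel of order j as the defect of a
    Schwinger-Dyson equation that involves moments of length at most k + 1
    ([stein_kernel_mean]); the defect is zero once these agree with those of
    the free family. *)

Local Notation basis := Defs.basis.

(** * Decompositions of a word around a letter *)

Section Splits.
Context (n : nat).
Implicit Types (i j : 'I_n) (w : seq 'I_n).

Lemma splits_cons j i w :
  splits j (i :: w) =
    (if i == j then [:: (FMonom [::], FMonom w)] else [::]) ++
    [seq (FMonom (i :: s.1), s.2) |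
       s : fmonom 'I_n * fmonom 'I_n <- splits j w].
Proof.
rewrite /splits /= (iotaDl 1 0) filter_map -map_comp.
rewrite (_ : (Some i == Some j) = (i == j)) //.
by case: (i == j) => //=; rewrite ?drop0 -map_comp.
Qed.

Lemma splits_rcons i j w :
  splits i (rcons w j) =
    [seq (s.1, FMonom (rcons s.2 j)) |
       s : fmonom 'I_n * fmonom 'I_n <- splits i w] ++
    (if j == i then [:: (FMonom w, FMonom [::])] else [::]).
Proof.
elim: w => [|k w IH]; first by rewrite /= splits_cons /= cats0.
rewrite rcons_cons !splits_cons IH !map_cat -!map_comp catA; congr (_ ++ _).
  by congr (_ ++ _); case: eqP.
by case: eqP.
Qed.

Lemma splits_size1 i w (s : fmonom 'I_n * fmonom 'I_n) :
  s \in splits i w -> (size s.1 < size w)%N.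
Proof.
case/mapP => p; rewrite mem_filter mem_iota /= add0n => /andP [_ pw] -> /=.
by rewrite size_take pw.
Qed.

Lemma splits_size2 i w (s : fmonom 'I_n * fmonom 'I_n) :
  s \in splits i w -> (size s.2 < size w)%N.
Proof.
case/mapP => p; rewrite mem_filter mem_iota /= add0n => /andP [_ pw] -> /=.
by rewrite size_drop ltn_subrL /= (leq_ltn_trans _ pw).
Qed.

End Splits.

(** * The vacuum functional *)

Section FockFunctional.
Context (K : comNzRingType) (n : nat) (v : K).
Implicit Types (w u : seq 'I_n) (i j : 'I_n).

(** On the Fock space with basis e_u, u a word, the letter i acts by
    e_u |-> e_(iu) + v e_u' if u = iu', and by e_u |-> e_(iu) otherwise. This is
    the coefficient of the vacuum e_[::] in the image of e_u under the letters
    of w. The head of w acts first, so w is an operator product read from right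
    to left; this makes the recursion structural. *)
Fixpoint vacuum_coef w u : K :=
  match w with
  | [::] => (u == [::])%:R
  | i :: w' =>
      vacuum_coef w' (i :: u) +
      (if u is j :: u' then if i == j then v * vacuum_coef w' u' else 0 else 0)
  end.

(** The vacuum is reached only after the last letter j of the basis vector
    has been annihilated by some occurrence of j in w. Before that occurrence
    the letters of w act above j as they act on e_u, and must bring u to the
    vacuum; afterwards they act on the vacuum itself. *)
Lemma vacuum_coef_rcons w u j :
  vacuum_coef w (rcons u j) =
  v * \sum_(s <- splits j w) vacuum_coef s.1 u * vacuum_coef s.2 [::].
Proof.
elim: w u => [|i w IH] u /=.
  by rewrite /splits big_nil mulr0; case: u.
rewrite splits_cons big_cat /= big_map -rcons_cons IH.
under [X in _ = v * (_ + X)]eq_bigr do rewrite /= mulrDl.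
rewrite big_split /= addrCA mulrDr; congr (_ + _).
case: u => [|k u] /=.
  rewrite [X in _ + X]big1 ?addr0; last by move=> s _; rewrite mul0r.
  by case: eqP => _; rewrite ?big_seq1 /= ?mul1r // big_nil mulr0.
rewrite [X in X + _](_ : _ = 0) ?add0r; last first.
  by case: (i == j); rewrite ?big_nil // big_seq1 /= mul0r.
case: eqP => _; last by rewrite big1 ?mulr0 // => s _; rewrite mul0r.
rewrite IH; congr (_ * _); rewrite big_distrr /=.
by under eq_bigr do rewrite mulrA.
Qed.

(** The Schwinger-Dyson equation of the vacuum functional. *)
Lemma vacuum_coef_cons w i :
  vacuum_coef (i :: w) [::] =
  v * \sum_(s <- splits i w) vacuum_coef s.1 [::] * vacuum_coef s.2 [::].
Proof. by rewrite /= addr0 (vacuum_coef_rcons _ [::]). Qed.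

End FockFunctional.

(** * Moments of the semicircle law *)

Section Segner.
Context (F : numFieldType) (v : F) (m : nat -> F).
(* The odd terms are zero and the even ones are v^p times Catalan numbers. *)
Hypotheses (m0 : m 0%N = 1) (m1 : m 1%N = 0)
  (m_rec : forall d, (d + 4)%:R * m d.+2 = 4 * v * d.+1%:R * m d).

Let conv d := \sum_(a < d.+1) m a * m (d - a)%N.

(** Exchanging the two factors of the convolution replaces a by d - a, so the
    average weight is d / 2. *)
Lemma conv_weighted d :
  2 * (\sum_(a < d.+1) (nat_of_ord a)%:R * (m a * m (d - a)%N)) =
  d%:R * conv d.
Proof.
rewrite mulr2n mulrDl mul1r {1}(reindex_inj rev_ord_inj) /= -big_split /=.
rewrite /conv mulr_sumr; apply: eq_bigr => a _; rewrite subSS.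
have ad : (a <= d)%N by rewrite -ltnS.
by rewrite subKn // (mulrC (m a)) -mulrDl -natrD subnK.
Qed.

(** The convolution with weight a + 2 is computed twice: by symmetry it is
    (d + 6) / 2 times [conv], and term by term [m_rec] turns it into a weighted
    convolution of lower order. *)
Lemma conv_rec d :
  (d + 6)%:R * conv d.+2 = 4 * m d.+2 + 4 * v * (d + 2)%:R * conv d.
Proof.
have E : 2 * (\sum_(a < d.+3) (nat_of_ord a + 2)%:R * (m a * m (d.+2 - a)%N)) =
   (d + 6)%:R * conv d.+2.
  under eq_bigr do rewrite natrD mulrDl.
  rewrite big_split /= mulrDr conv_weighted -mulr_sumr -/(conv _) mulrA -mulrDl.
  by congr (_ * _); rewrite -natrM -natrD -addn2 -addnA.
(* The term of index 1 is zero, that of index 0 is 2 * m d.+2. *)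
rewrite -E 2!big_ord_recl /= m0 m1 mul0r mulr0 mul1r subn0 add0r add0n.
rewrite (eq_bigr (fun a : 'I_d.+1 =>
  4 * v * ((nat_of_ord a)%:R * (m a * m (d - a)%N) + m a * m (d - a)%N))).
  rewrite -mulr_sumr big_split /= -/(conv d); set T := \sum_(a < _) _.
  transitivity (4 * m d.+2 + 4 * v * (2 * T + 2 * conv d)); first by ring.
  by rewrite conv_weighted natrD; ring.
move=> a _; rewrite /bump /= !add1n !subSS mulrA.
rewrite (_ : (_ + 2)%:R = (a + 4)%:R); last by rewrite !(addSn, addnS).
by rewrite m_rec -[a.+1]addn1 natrD; ring.
Qed.

(** Both sides satisfy the same two-term recursion, the right-hand side by
    [conv_rec] once the equation is known two steps lower. *)
Lemma segner d : m d.+2 = v * conv d.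
Proof.
have step e : m e.+2 = v * conv e -> m e.+4 = v * conv e.+2.
  move=> IH; have e6 : (e + 6)%:R != 0 :> F by rewrite pnatr_eq0 addnS.
  apply: (mulfI e6).
  rewrite mulrCA conv_rec (_ : (e + 6) = e.+2 + 4)%N; last by rewrite !addSnnS.
  rewrite m_rec [in RHS]mulrDr.
  rewrite (_ : v * (4 * v * (e + 2)%:R * conv e) = 4 * v * (e + 2)%:R * m e.+2).
    by rewrite -[e.+3]addn1 -[e.+2]addn2 !natrD; ring.
  by rewrite IH; ring.
suff: m d.+2 = v * conv d /\ m d.+3 = v * conv d.+1 by case.
elim: d => [|d [IH0 IH1]]; last by split; [|exact: step].
have nz e : e.+1%:R != 0 :> F by rewrite pnatr_eq0.
split.
  rewrite /conv big_ord1 /= m0 mulr1 mulr1; apply: (mulfI (nz 3)).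
  by rewrite (m_rec 0) m0; ring.
rewrite /conv !big_ord_recl big_ord0 /= m0 m1 !(mul0r, mulr0, addr0).
by apply: (mulfI (nz 4)); rewrite (m_rec 1) m1 !mulr0.
Qed.

End Segner.

Section SemicircleIntegral.
Local Open Scope classical_set_scope.
Context (R : realType) (v : R) (v_gt0 : 0 < v).

Let c := (2 * pi * v)^-1.
Let y (x : R) := 4 * v - x ^+ 2.
Let dens (d : nat) (x : R) := x ^+ d * (c * Num.sqrt (y x)).
(* The primitive that vanishes at both ends of the support and whose derivative
   combines two consecutive moments of equal parity. *)
Let prim (d : nat) (x : R) := x ^+ d * (c * (y x * Num.sqrt (y x))).

Lemma sqr_edge : (2 * Num.sqrt v) ^+ 2 = 4 * v.
Proof. by rewrite exprMn sqr_sqrtr ?(ltW v_gt0) // -natrX. Qed.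

Lemma is_derive_prim d x : 0 < y x ->
  is_derive x 1 (prim d)
    (4 * v * d%:R * dens d.-1 x - (d + 3)%:R * dens d.+1 x).
Proof.
move=> y_gt0; set s := Num.sqrt (y x).
have s_neq0 : s != 0 by rewrite gt_eqF // sqrtr_gt0.
have yE : y x = s * s by rewrite -expr2 sqr_sqrtr // ltW.
have Dx e : is_derive x 1 (fun z : R => z ^+ e) (e%:R * x ^+ e.-1).
  by apply: DeriveDef; [exact: exprn_derivable|rewrite exp_derive [LHS]mulr1].
have Dy : is_derive x 1 y (- (2 * x)).
  have := is_deriveB (is_derive_cst (4 * v) x 1) (Dx 2).
  by rewrite sub0r expr1.
have Ds := is_derive1_comp (is_derive1_sqrt y_gt0) Dy.
have Dc := is_deriveM (is_derive_cst c x 1) (is_deriveM Dy Ds).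
have D : is_derive x 1 (prim d) _ := is_deriveM (Dx d) Dc.
apply: (is_derive_eq D); rewrite /dens -/s /= /GRing.scale /= -/s.
rewrite mulr0 addr0 (_ : y x * ((2 * s)^-1 * - (2 * x)) = - (s * x)); last first.
  by rewrite yE; field.
rewrite -[(cst c * _) x]/(c * (y x * s)) {1}/y.
clearbody s; case: d {D} => [|d] /=; first by ring.
by rewrite !exprS natrD; ring.
Qed.

Lemma continuous_y : continuous y.
Proof.
move=> x; apply: cvgB; first exact: cvg_cst.
exact: exprn_continuous.
Qed.

Lemma continuous_dens d : continuous (dens d).
Proof.
move=> x; apply: cvgM; first exact: exprn_continuous.
apply: cvgM; first exact: cvg_cst.
apply: continuous_comp; first exact: continuous_y.
exact: sqrt_continuous.
Qed.

Lemma continuous_prim d : continuous (prim d).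
Proof.
move=> x; apply: cvgM; first exact: exprn_continuous.
apply: cvgM; first exact: cvg_cst.
apply: cvgM; first exact: continuous_y.
apply: continuous_comp; first exact: continuous_y.
exact: sqrt_continuous.
Qed.

Lemma integrable_dens k d (a b : R) :
  (@lebesgue_measure R).-integrable `[a, b] (EFin \o (fun x => k * dens d x)).
Proof.
apply: continuous_compact_integrable; first exact: segment_compact.
apply: continuous_subspaceT => x.
by apply: cvgM; [exact: cvg_cst|exact: continuous_dens].
Qed.

(** The boundary terms vanish because the density is zero at the edges. For
    d = 0 the right-hand side is zero, whence the first moment is zero. *)
Lemma semicircle_moment_rec d :
  (d + 3)%:R * semicircle_moment v d.+1 =
  4 * v * d%:R * semicircle_moment v d.-1.
Proof.
set a := 2 * Num.sqrt v.
have a_gt0 : 0 < a by rewrite mulr_gt0 // sqrtr_gt0.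
have ya : y a = 0 by rewrite /y sqr_edge subrr.
have yNa : y (- a) = 0 by rewrite /y sqrrN sqr_edge subrr.
have y_gt0 x : x \in Interval (BRight (- a)) (BLeft a) -> 0 < y x.
  rewrite in_itv /= -ltr_norml => xa.
  rewrite /y -sqr_edge -/a subr_gt0 -real_normK ?num_real //.
  by rewrite ltr_pXn2r ?nnegrE // ltW.
pose f x := 4 * v * d%:R * dens d.-1 x - (d + 3)%:R * dens d.+1 x.
have FTC : (\int[lebesgue_measure]_(x in `[(- a)%R, a]) (f x)%:E =
    (prim d a)%:E - (prim d (- a)%R)%:E)%E.
  apply: continuous_FTC2.
  - by rewrite gtrN.
  - apply: continuous_subspaceT => x; apply: cvgB;
      by apply: cvgM; [exact: cvg_cst|exact: continuous_dens].
  - split.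
    + by move=> x /y_gt0/(is_derive_prim d) [].
    + by apply: cvg_at_right_filter; exact: continuous_prim.
    + by apply: cvg_at_left_filter; exact: continuous_prim.
  - move=> x /y_gt0/(is_derive_prim d) D.
    by rewrite derive1E; exact: (@derive_val _ _ _ _ _ _ _ D).
have : \int[lebesgue_measure]_(x in `[- a, a]) f x = 0.
  by rewrite /Rintegral FTC /prim ya yNa !(mul0r, mulr0) subee.
have intZ k e : \int[lebesgue_measure]_(x in `[- a, a]) (k * dens e x) =
    k * semicircle_moment v e.
  rewrite RintegralZl //.
  rewrite (_ : dens e = (fun x => 1 * dens e x)); first exact: integrable_dens.
  by apply/funext => x; rewrite mul1r.
rewrite RintegralB //; [|exact: integrable_dens..].
by rewrite !intZ => /eqP; rewrite subr_eq0 => /eqP.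
Qed.

Lemma semicircle_moment_segner d : semicircle_moment v 0 = 1 ->
  semicircle_moment v d.+2 =
  v * \sum_(a < d.+1) semicircle_moment v a * semicircle_moment v (d - a)%N.
Proof.
move=> m0; apply: segner => // [|e].
  have /eqP := semicircle_moment_rec 0.
  by rewrite mulr0 mul0r mulf_eq0 pnatr_eq0 => /eqP.
by rewrite addnS -addSn semicircle_moment_rec.
Qed.

End SemicircleIntegral.

(** * Moments of a free semicircular family *)

Section FreeSemicircular.
Local Open Scope complex_scope.
Context (R : realType) (N : tracial_wstar R) (n : nat) (v : R) (S : 'I_n -> N).
Hypotheses (v_gt0 : 0 < v) (S_free : free_semicircular v S).

Let V : R[i] := v%:C.

Lemma sum_splits_nseq (i : 'I_n) m (f : seq 'I_n -> seq 'I_n -> R[i]) :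
  \sum_(s <- splits i (nseq m i)) f s.1 s.2 =
  \sum_(a < m) f (nseq a i) (nseq (m.-1 - a) i).
Proof.
elim: m f => [|m IH] f; first by rewrite /splits big_nil big_ord0.
rewrite [nseq _ _]/= splits_cons eqxx cat1s big_cons big_map big_ord_recl subn0.
rewrite (IH (fun s t => f (i :: s) t)); congr (_ + _).
by apply: eq_bigr => a _; rewrite lift0 subnS predn_sub.
Qed.

(** For a word with a single letter the Schwinger-Dyson equation of the vacuum
    is the convolution recursion of the semicircle moments. *)
Lemma vacuum_coef_nseq (i : 'I_n) m :
  vacuum_coef V (nseq m i) [::] = (semicircle_moment v m)%:C.
Proof.
(* The total mass is 1 because the trace of the unit is 1. *)
have m0 : semicircle_moment v 0 = 1.
  have [_ /(_ 0%N)] := S_free.1 i; rewrite expr0 tau1 => /esym.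
  by case.
elim/ltn_ind: m => -[|[|m]] IH; first by rewrite m0.
  rewrite /= addr0 /=.
  have /eqP := semicircle_moment_rec v_gt0 0.
  by rewrite mulr0 mul0r mulf_eq0 pnatr_eq0 => /eqP ->.
rewrite [nseq _ _]/= vacuum_coef_cons.
rewrite (sum_splits_nseq _ m.+1
  (fun s t => vacuum_coef V s [::] * vacuum_coef V t [::])).
rewrite semicircle_moment_segner // rmorphM rmorph_sum /=; congr (_ * _).
apply: eq_bigr => a _; rewrite rmorphM !IH //.
  by rewrite ltnS (leq_trans (leq_subr _ _)).
by rewrite (leq_trans (ltn_ord a)).
Qed.

(** Chebyshev polynomials of the second kind, rescaled to be monic and
    orthogonal for the semicircle law of variance v. *)
Fixpoint cheb d : {poly R[i]} :=
  match d with
  | 0 => 1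
  | d1.+1 => if d1 is d2.+1 then 'X * cheb d1 - V *: cheb d2 else 'X
  end.

Lemma chebSS d : cheb d.+2 = 'X * cheb d.+1 - V *: cheb d.
Proof. by []. Qed.

Definition cheb_at i d : N := horner_alg (S i) (cheb d).

Lemma cheb_at0 i : cheb_at i 0 = 1.
Proof. by rewrite /cheb_at rmorph1. Qed.

Lemma cheb_at1 i : cheb_at i 1 = S i.
Proof. by rewrite /cheb_at /= horner_algX. Qed.

Lemma cheb_atSS i d : S i * cheb_at i d.+1 = cheb_at i d.+2 + V *: cheb_at i d.
Proof.
rewrite /cheb_at chebSS rmorphB rmorphM /= horner_algX linearZ /= mulr_algl.
by rewrite subrK.
Qed.

(** Both sides satisfy the three-term recurrence in d, for all m at once; for
    d = 0 they are the moments. *)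
Lemma tau_pow_cheb i m d :
  tau N (S i ^+ m * cheb_at i d) = vacuum_coef V (nseq m i) (nseq d i).
Proof.
suff: forall m,
   tau N (S i ^+ m * cheb_at i d) = vacuum_coef V (nseq m i) (nseq d i) /\
   tau N (S i ^+ m * cheb_at i d.+1) = vacuum_coef V (nseq m i) (nseq d.+1 i).
  by move=> /(_ m) [].
elim: d {m} => [|d IH] m.
  rewrite cheb_at0 cheb_at1 mulr1 -exprSr.
  have semi := (S_free.1 i).2.
  by rewrite !semi -!(vacuum_coef_nseq i) /= addr0.
split; first by case: (IH m).
have [IH0 _] := IH m; have [_] := IH m.+1.
rewrite exprSr -mulrA cheb_atSS mulrDr raddfD /= -scalerAr linearZ /= IH0 eqxx.
exact: addIr.
Qed.

Lemma tau_cheb i d : tau N (cheb_at i d.+1) = 0.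
Proof. by have := tau_pow_cheb i 0 d.+1; rewrite expr0 mul1r. Qed.

(** Run-length encoding: the pair (j, d) stands for a block of d + 1 letters j,
    so that blocks are never empty. *)
Definition push (i : 'I_n) (b : seq ('I_n * nat)) :=
  if b is (j, d) :: b' then
    if i == j then (j, d.+1) :: b' else (i, 0%N) :: b
  else [:: (i, 0%N)].

Definition blocks (u : seq 'I_n) := foldr push [::] u.

Lemma blocks_push i u : blocks (i :: u) = push i (blocks u).
Proof. by []. Qed.

Lemma blocks_cons i u : exists d b, blocks (i :: u) = (i, d) :: b.
Proof.
rewrite /= /push; case: (blocks u) => [|[j d] b]; first by exists 0%N, [::].
by case: eqP => [<-|_]; do 2 eexists.
Qed.

Lemma blocks_sorted u : sorted (fun p q : 'I_n * nat => p.1 != q.1) (blocks u).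
Proof.
elim: u => //= i u; rewrite /push; case: (blocks u) => [|[j d] b] //=.
by case: eqP => [_|/eqP ij] /=; [case: b|move=> ->; rewrite ij].
Qed.

(** The image in the algebra of the Fock basis vector e_u. *)
Definition cheb_word u : N := \prod_(p <- blocks u) cheb_at p.1 p.2.+1.

(** The blocks of a nonempty word give an alternating product of centered
    elements, to which freeness applies. *)
Lemma tau_cheb_word u : tau N (cheb_word u) = (u == [::])%:R.
Proof.
case: u => [|i u]; first by rewrite /cheb_word big_nil tau1.
have [d [b E]] := blocks_cons i u.
have := S_free.2 [seq (p.1, cheb p.2.+1) | p <- blocks (i :: u)].
rewrite big_map; apply.
- by rewrite E.
- by rewrite sorted_map; exact: blocks_sorted.
- by move=> _ /mapP [p _ ->]; exact: tau_cheb.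
Qed.

(** Left multiplication by a variable is creation plus v times annihilation:
    it lengthens the first block, by the three-term recurrence, or opens a new
    one. *)
Lemma mul_cheb_word i u :
  S i * cheb_word u = cheb_word (i :: u) +
    (if u is j :: u' then if i == j then V *: cheb_word u' else 0 else 0).
Proof.
case: u => [|j u].
  by rewrite /cheb_word /= big_nil big_seq1 /= cheb_at1 mulr1 addr0.
case: eqP => [<-|/eqP/negPf ij]; last first.
  have [d [b E]] := blocks_cons j u.
  rewrite addr0 /cheb_word (blocks_push i) E /push ij [RHS]big_cons /=.
  by rewrite cheb_at1.
rewrite /cheb_word !blocks_push.
case: (blocks u) => [|[k d] b].
  by rewrite /= eqxx big_nil !big_seq1 /= cheb_atSS cheb_at0.
rewrite /push; case: eqP => [<-|_]; rewrite eqxx !big_cons /=.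
  by rewrite mulrA cheb_atSS mulrDl scalerAl.
by rewrite mulrA cheb_atSS mulrDl cheb_at0 -scalerAl mul1r.
Qed.

Lemma tau_word_cheb_word w u :
  tau N (word_eval S (FMonom (rev w)) * cheb_word u) = vacuum_coef V w u.
Proof.
rewrite /word_eval /=; elim: w u => [|i w IH] u.
  by rewrite big_nil mul1r tau_cheb_word.
rewrite rev_cons -cats1 big_cat big_seq1 /= -mulrA mul_cheb_word.
rewrite mulrDr raddfD /= IH.
congr (_ + _); case: u => [|j u]; first by rewrite mulr0 raddf0.
by case: eqP => _; rewrite ?mulr0 ?raddf0 // -scalerAr linearZ /= IH.
Qed.

Lemma tau_semicircular w :
  tau N (word_eval S (FMonom (rev w))) = vacuum_coef V w [::].
Proof. by rewrite -tau_word_cheb_word /cheb_word big_nil mulr1. Qed.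

End FreeSemicircular.

(** * Linear extension from a basis *)

Section LinearExtension.
Context (R : realType) (K : choiceType).
Local Open Scope fset_scope.

Section Linext.
Context (V : lmodType R[i]) (f : K -> V).

Lemma linextEw (d : {fset K}) (g : malg K R[i]) : msupp g `<=` d ->
  linext f g = \sum_(k <- d) mcoeff k g *: f k.
Proof.
move=> gd; rewrite /linext (big_fset_incl _ gd) // => k _.
by move/mcoeff_outdom => ->; rewrite scale0r.
Qed.

Lemma linext_is_linear : linear (linext f).
Proof.
move=> a g h; set d := msupp g `|` msupp h.
have gd : msupp g `<=` d by apply: fsubsetUl.
have hd : msupp h `<=` d by apply: fsubsetUr.
have agd : msupp (a *: g + h) `<=` d.
  apply: fsubset_trans (msuppD_le _ _) _; apply: fsetSU; exact: msuppZ_le.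
rewrite (linextEw gd) (linextEw hd) (linextEw agd) scaler_sumr -big_split /=.
by apply: eq_bigr => k _; rewrite mcoeffD mcoeffZ scalerDl scalerA.
Qed.

HB.instance Definition _ :=
  GRing.isLinear.Build R[i] (malg K R[i]) V *:%R (linext f) linext_is_linear.

Lemma linext_basis k : linext f (basis R k) = f k.
Proof.
rewrite (linextEw (d := [fset k])) ?msuppU_le // big_seq_fset1.
by rewrite /basis mcoeffUU scale1r.
Qed.

Lemma linext_sum_basis (I : Type) (s : seq I) (h : I -> K) :
  linext f (\sum_(x <- s) basis R (h x)) = \sum_(x <- s) f (h x).
Proof. by rewrite raddf_sum; apply: eq_bigr => x _; exact: linext_basis. Qed.

(** The coefficients of a sum of basis elements are natural numbers, so
    conjugating them changes nothing. *)
Lemma semilinext_sum_basis (I : Type) (s : seq I) (h : I -> K) :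
  semilinext f (\sum_(x <- s) basis R (h x)) = \sum_(x <- s) f (h x).
Proof.
rewrite -(linext_sum_basis s h) /linext /semilinext; apply: eq_bigr => k _.
congr (_ *: _); rewrite !raddf_sum /=; apply: eq_bigr => x _.
by rewrite /basis mcoeffU /= rmorph_nat.
Qed.

End Linext.
End LinearExtension.

(** * The involution *)

Section Star.
Context (R : realType) (M : wstar R).

Lemma inner_ext (H : hilbert R) (x y : H) :
  (forall u, inner H u x = inner H u y) -> x = y.
Proof.
move=> E; apply/eqP; rewrite -subr_eq0 -normr_eq0 -sqrf_eq0 inner_norm.
by rewrite linearBr /= E subrr.
Qed.

(** The representation is faithful and turns the involution into the adjoint,
    so the algebraic rules of adjoints transfer. *)
Lemma starM (x y : M) : star (x * y) = star y * star x.
Proof.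
apply: rep_inj => u; apply: inner_ext => z.
by rewrite repM -!rep_star repM.
Qed.

Lemma star1 : star (1 : M) = 1.
Proof.
apply: rep_inj => u; apply: inner_ext => z.
by rewrite -rep_star !rep1.
Qed.

Lemma star0 : star (0 : M) = 0.
Proof.
apply: rep_inj => u; apply: inner_ext => z; rewrite -rep_star.
have rep0 y : rep (0 : M) y = 0.
  by have := rep_linear (-1) (0 : M) 0 y; rewrite scaler0 addr0 scaleN1r addNr.
by rewrite !rep0 linear0l linear0r.
Qed.

Lemma star_word n (X : 'I_n -> M) (hX : forall i, selfadjoint (X i)) w :
  star (word_eval X (FMonom w)) = word_eval X (FMonom (rev w)).
Proof.
rewrite /word_eval /=; elim: w => [|i w IH]; first by rewrite !big_nil star1.
by rewrite big_cons starM IH hX rev_cons -cats1 big_cat big_seq1.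
Qed.

End Star.

(** * Iterated difference quotients of words *)

Section Words.
Context (R : realType) (n : nat).
Implicit Types (i j : 'I_n) (w a u : seq 'I_n).

Notation word := (fmonom 'I_n).
Definition empties k : k.-tuple word := nseq_tuple k (FMonom [::]).

HB.instance Definition _ := GRing.Linear.copy (@tens1 R n)
  (linext (fun w : word => basis R [tuple w])).

HB.instance Definition _ m j := GRing.Linear.copy (@fdq_head R n m j)
  (linext (fun l : m.+1.-tuple word =>
     \sum_(s <- splits j (thead l)) basis R [tuple of s.1 :: s.2 :: behead l])).

Lemma fdq_head_basis m j (l : m.+1.-tuple word) :
  fdq_head j (basis R l) =
  \sum_(s <- splits j (thead l)) basis R [tuple of s.1 :: s.2 :: behead l].
Proof. exact: linext_basis. Qed.

(** Each derivative acts on the head factor. The terms listed in s have lost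
    more letters from the head than were differentiated, because some derivative
    did not hit the last letter of the head; they cannot recover, and die out
    when the head is exhausted. The remaining term is the one where the
    derivatives consume u letter by letter from its end. *)
Lemma fdq_iter_cat k (t : k.-tuple 'I_n) a u : size u = k ->
  exists2 s : seq (k.+1.-tuple word),
    (forall l, l \in s -> (size (thead l) < size a)%N) &
    fdq_iter t (basis R (FMonom (a ++ u))) =
      (if u == t then basis R [tuple of FMonom a :: empties k] else 0)
      + \sum_(l <- s) basis R l.
Proof.
elim: k t a u => [|k IH] t a u.
  case: u => // _; exists [::] => //.
  rewrite big_nil addr0 cats0 (tuple0 t) /= /tens1 linext_basis.
  by congr basis; apply: val_inj.
case: u => // j u [su].
have [s hs E] := IH (behead_tuple t) (rcons a j) u su.
rewrite -cat_rcons [fdq_iter _ _]/= E raddfD /=.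
(* The terms of the derivative of the basis element l. *)
pose next (l : k.+1.-tuple word) : seq (k.+2.-tuple word) :=
  [seq [tuple of s.1 :: s.2 :: behead l] | s <- splits (thead t) (thead l)].
have next_lt (l : k.+1.-tuple word) b : (size (thead l) <= size b)%N ->
    forall l' : k.+2.-tuple word, l' \in next l -> (size (thead l') < size b)%N.
  by move=> lb _ /mapP [x /splits_size1 x1 ->]; exact: leq_trans x1 lb.
have -> : fdq_head (thead t) (\sum_(l <- s) basis R l) =
    \sum_(l <- flatten [seq next l | l <- s]) basis R l.
  rewrite big_flatten big_map /fdq_head linext_sum_basis.
  by apply: eq_bigr => l _; rewrite [RHS]big_map.
have flat_lt (l : k.+2.-tuple word) :
    l \in flatten [seq next l | l <- s] -> (size (thead l) < size a)%N.
  move=> /flattenP [_ /mapP [l0 /hs l0s ->]]; apply: next_lt.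
  by move: l0s; rewrite size_rcons.
rewrite [in j :: u == _](tuple_eta t) /= eqseq_cons.
case: (u == behead t); last first.
  rewrite andbF raddf0 add0r.
  by exists (flatten [seq next l | l <- s]); rewrite ?add0r.
rewrite andbT fdq_head_basis theadE splits_rcons big_cat /=.
(* Differentiating FMonom (rcons a j) at its last letter gives the main term,
   at any other letter it gives a term with a head shorter than a. *)
exists ([seq [tuple of s.1 :: FMonom (rcons s.2 j) :: empties k] |
           s : word * word <- splits (thead t) a]
        ++ flatten [seq next l | l <- s]).
  move=> l; rewrite mem_cat => /orP [/mapP [x /splits_size1 x1 ->] //|].
  exact: flat_lt.
rewrite big_cat /= addrA; congr (_ + _); rewrite addrC; congr (_ + _).
  case: eqP => _; rewrite ?big_seq1 ?big_nil //.
  by congr basis; apply: val_inj.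
rewrite big_map [RHS]big_map; apply: eq_bigr => x _.
by congr basis; apply: val_inj.
Qed.

Lemma fdq_iter_word k (t : k.-tuple 'I_n) w : size w = k ->
  fdq_iter t (basis R (FMonom w)) =
  if w == t then basis R (empties k.+1) else 0.
Proof.
(* No head is shorter than the empty word, so there are no other terms. *)
move=> /(fdq_iter_cat t [::]) [[|l s] hs ->]; last first.
  by have := hs l (mem_head _ _).
rewrite big_nil addr0; case: ifP => // _.
by congr basis; apply: val_inj.
Qed.

Lemma fdq_iter0 k (t : k.-tuple 'I_n) : fdq_iter t (0 : ncpoly R n) = 0.
Proof. by elim: k t => [|k IH] t /=; rewrite ?IH raddf0. Qed.

Lemma fdq_iter_short k (t : k.-tuple 'I_n) w : (size w < k)%N ->
  fdq_iter t (basis R (FMonom w)) = 0.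
Proof.
elim: k t => // k IH t.
rewrite ltnS leq_eqVlt /= => /orP [/eqP sw|sw]; last first.
  by rewrite IH // raddf0.
rewrite fdq_iter_word //; case: ifP => _; last exact: raddf0.
by rewrite fdq_head_basis /splits big_nil.
Qed.

End Words.

(** * The kernel equation tested on words *)

Section Stein.
Local Open Scope complex_scope.
Context (R : realType) (M : tracial_wstar R) (n : nat) (X : 'I_n -> M).
Hypothesis hX : forall i, selfadjoint (X i).

Implicit Types (i j : 'I_n) (w : seq 'I_n).
Notation word := (fmonom 'I_n).

HB.instance Definition _ := GRing.Linear.copy (@nceval R n M X)
  (linext (word_eval X)).

HB.instance Definition _ m := GRing.Linear.copy (@tens_eval R M n X m)
  (linext (fun w : m.-tuple word => basis R (map_tuple (word_eval X) w))).

Lemma cyclic_gradient_sqr (i j : 'I_n) :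
  cyclic_gradient (ncvar R i ^+ 2) j = if i == j then ncvar R j *+ 2 else 0.
Proof.
have -> : ncvar R i ^+ 2 = basis R (FMonom [:: i; i]).
  by rewrite expr2 malgM_def fgmulUU mulr1 [monalg.mul _ _]fmmulE.
rewrite /cyclic_gradient linext_basis !splits_cons.
case: eqP => [->|_]; last by rewrite big_nil.
by rewrite 2!big_cons big_nil addr0 -mulr2n.
Qed.

Lemma cyclic_gradient_quadratic (rho : R) j :
  cyclic_gradient (quadratic_potential n rho) j = rho%:C *: ncvar R j.
Proof.
transitivity ((rho / 2)%:C *: \sum_i cyclic_gradient (ncvar R i ^+ 2) j).
  rewrite /quadratic_potential /cyclic_gradient linearZ /=; congr (_ *: _).
  exact: raddf_sum.
rewrite (eq_bigr _ (fun i _ => cyclic_gradient_sqr i j)).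
rewrite -big_mkcond big_pred1_eq.
rewrite -scalerMnr scalerMnl -rmorphMn /=; congr (_%:C *: _).
by rewrite -mulr_natr divfK // pnatr_eq0.
Qed.

Definition single_component (i : 'I_n) w : 'I_n -> ncpoly R n :=
  fun j => if j == i then basis R (FMonom w) else 0.

Lemma nceval_basis w : nceval X (basis R (FMonom w)) = word_eval X (FMonom w).
Proof. exact: linext_basis. Qed.

Lemma word_eval1 i : word_eval X (FMonom [:: i]) = X i.
Proof. by rewrite /word_eval big_seq1. Qed.

Lemma tuple_inner_single rho i w :
  tuple_inner (fun j => nceval X (cyclic_gradient (quadratic_potential n rho) j))
              (fun j => nceval X (single_component i w j)) =
  rho%:C * tau M (word_eval X (FMonom (rev (i :: w)))).
Proof.
rewrite /tuple_inner (bigD1 i) //= big1 => [|j /negPf ji]; last first.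
  by rewrite /single_component ji raddf0 star0 mul0r raddf0.
rewrite addr0 /single_component eqxx cyclic_gradient_quadratic.
rewrite linearZ /= !nceval_basis.
rewrite star_word // word_eval1 -scalerAr linearZ /=; congr (_ * tau M _).
by rewrite rev_cons -cats1 /word_eval big_cat big_seq1.
Qed.

Lemma tens_tau_star_sum (I : Type) (r : seq I) (a b : I -> word) :
  tens_tau (tens_star (\sum_(s <- r) tens_eval X (basis R [tuple a s; b s]))) =
  \sum_(s <- r) tau M (word_eval X (FMonom (rev (a s)))) *
                tau M (word_eval X (FMonom (rev (b s)))).
Proof.
under [X in tens_star X]eq_bigr do rewrite /tens_eval linext_basis.
rewrite /tens_star semilinext_sum_basis.
rewrite -[LHS]/(linext (V := R[i]^o)
  (fun a : 2.-tuple M => \prod_(i < 2) tau M (tnth a i)) _).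
rewrite linext_sum_basis; apply: eq_bigr => s _.
rewrite big_ord_recl big_ord1 !tnth_map /= !(tnth_nth (FMonom [::])) /=.
by rewrite -[a s]fmK -[b s]fmK !star_word // !fmK.
Qed.

Lemma fdq_word j w :
  fdq j (basis R (FMonom w)) =
  \sum_(s <- splits j w) basis R [tuple s.1; s.2].
Proof.
rewrite /fdq /tens1 linext_basis fdq_head_basis; apply: eq_bigr => s _.
by congr basis; apply: val_inj.
Qed.

Lemma tens_tau_jacobian i w :
  tens_tau (\tr (mx_star (map_mx (tens_eval X (m := 2))
                            (Defs.jacobian (single_component i w))))) =
  \sum_(s <- splits i w) tau M (word_eval X (FMonom (rev s.1))) *
                         tau M (word_eval X (FMonom (rev s.2))).
Proof.
rewrite -tens_tau_star_sum; congr tens_tau.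
rewrite /mxtrace (bigD1 i) //= big1 => [|j /negPf ji];
  rewrite !mxE /single_component.
  by rewrite eqxx addr0 fdq_word raddf_sum.
rewrite ji /fdq !raddf0 /tens_star.
have := semilinext_sum_basis
  (fun a : 2.-tuple M => basis R (map_tuple (@star R M) a)) [::] id.
by rewrite !big_nil.
Qed.

(** The inner product and the trace pair with adjoints, and the adjoint of a
    word is the reversed word; hence the reversals. *)
Lemma stein_single_component rho k (L : tensL2 M k.+1)
    (A : k.+1.-tuple 'I_n -> L) i w :
  stein_kernel (quadratic_potential n rho) X A ->
  rho%:C * tau M (word_eval X (FMonom (rev (i :: w)))) -
  \sum_(s <- splits i w) tau M (word_eval X (FMonom (rev s.1))) *
                         tau M (word_eval X (FMonom (rev s.2))) =
  \sum_(t : k.+1.-tuple 'I_n)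
    inner L (A t)
      (l2_of L (tens_eval X (jacobian_iter (single_component i w) t))).
Proof.
move=> /(_ (single_component i w)).
by rewrite tuple_inner_single tens_tau_jacobian.
Qed.

(** Derivatives of order k kill words shorter than k. *)
Lemma schwinger_dyson rho k (L : tensL2 M k.+1)
    (A : k.+1.-tuple 'I_n -> L) i w :
  stein_kernel (quadratic_potential n rho) X A -> (size w < k)%N ->
  rho%:C * tau M (word_eval X (FMonom (rev (i :: w)))) =
  \sum_(s <- splits i w) tau M (word_eval X (FMonom (rev s.1))) *
                         tau M (word_eval X (FMonom (rev s.2))).
Proof.
move=> /stein_single_component E wk; apply/eqP.
rewrite -subr_eq0 E big1 // => t _.
rewrite /jacobian_iter /single_component; case: eqP => _.
  by rewrite fdq_iter_short // raddf0 /l2_of raddf0 linear0r.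
by rewrite fdq_iter0 raddf0 /l2_of raddf0 linear0r.
Qed.

(** Testing against the word behead t in the component thead t singles out the
    entry t of the kernel, paired with the unit tensor. *)
Lemma stein_kernel_mean rho k (L : tensL2 M k.+1) (A : k.+1.-tuple 'I_n -> L)
    (t : k.+1.-tuple 'I_n) :
  stein_kernel (quadratic_potential n rho) X A ->
  l2_tau (A t) =
  rho%:C * tau M (word_eval X (FMonom (rev t))) -
  \sum_(s <- splits (thead t) (behead t))
     tau M (word_eval X (FMonom (rev s.1))) *
     tau M (word_eval X (FMonom (rev s.2))).
Proof.
move=> /stein_single_component E; rewrite {2}(tuple_eta t) E.
rewrite (bigD1 t) //= big1 ?addr0 => [|t' t't]; last first.
  rewrite /jacobian_iter /single_component; case: eqP => [h|_].
    rewrite fdq_iter_word ?size_tuple //; case: eqP => [b|_].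
      case/eqP: t't; apply: val_inj; rewrite (tuple_eta t') (tuple_eta t) /=.
      by rewrite h b.
    by rewrite raddf0 /l2_of raddf0 linear0r.
  by rewrite fdq_iter0 raddf0 /l2_of raddf0 linear0r.
rewrite /jacobian_iter /single_component eqxx fdq_iter_word ?size_tuple // eqxx.
rewrite /l2_tau /tens_eval /l2_of !linext_basis.
congr (inner L _ (l2_pure L _)).
apply: val_inj; rewrite /= map_nseq; congr (_ :: nseq _ _);
  by rewrite /word_eval big_nil.
Qed.

End Stein.

(** * Comparison of the moments *)

Section Conclusion.
Local Open Scope complex_scope.
Context (R : realType) (n : nat) (rho : R) (rho_gt0 : 0 < rho).

(** Both functionals satisfy the Schwinger-Dyson recursion up to length k, and
    it determines them by induction on the length. *)
Lemma word_moments (M : tracial_wstar R) (X : 'I_n -> M) k :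
  (forall i w, (size w < k)%N ->
    rho%:C * tau M (word_eval X (FMonom (rev (i :: w)))) =
    \sum_(s <- splits i w) tau M (word_eval X (FMonom (rev s.1))) *
                           tau M (word_eval X (FMonom (rev s.2)))) ->
  forall w, (size w <= k)%N ->
    tau M (word_eval X (FMonom (rev w))) = vacuum_coef (rho^-1)%:C w [::].
Proof.
move=> SD w; have [m] := ubnP (size w).
elim: m w => // m IH [|i w] wm wk; first by rewrite /word_eval big_nil tau1.
have rhoK : (rho^-1)%:C * rho%:C = 1 :> R[i].
  by rewrite -rmorphM /= mulVf ?rmorph1 // gt_eqF.
rewrite vacuum_coef_cons -[LHS]mul1r -rhoK -mulrA SD //; congr (_ * _).
rewrite !big_seq; apply: eq_bigr => s /[dup] /splits_size1 s1 /splits_size2 s2.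
have lt_m x : (x < size w)%N -> (x < m)%N /\ (x <= k)%N.
  by move=> xw; split; [exact: ltn_trans xw wm|exact: ltnW (ltn_trans xw wk)].
have [s1m s1k] := lt_m _ s1; have [s2m s2k] := lt_m _ s2.
by rewrite !IH.
Qed.

End Conclusion.

Theorem lemma2 (R : realType) (rho : R) (hrho : 0 < rho) (k n : nat)
    (hk : (1 <= k)%N) (hn : (1 <= n)%N)
    (M : tracial_wstar R) (X : 'I_n -> M) (hX : forall i, selfadjoint (X i))
    (L2 : forall j : nat, tensL2 M j.+1)
    (A : forall j : nat, j.+1.-tuple 'I_n -> L2 j)
    (hA : forall j : nat, (1 <= j <= k)%N ->
       stein_kernel (quadratic_potential n rho) X (A j))
    (N : tracial_wstar R) (Srho : 'I_n -> N)
    (hS : free_semicircular rho^-1 Srho) :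
  (forall P : ncpoly R n, (ncdeg P <= k)%N ->
     tau M (nceval X P) = tau N (nceval Srho P)) /\
  ((forall P : ncpoly R n, ncdeg P = k.+1 ->
      tau M (nceval X P) = tau N (nceval Srho P)) ->
   forall j : nat, (1 <= j <= k)%N ->
   forall t : j.+1.-tuple 'I_n, l2_tau (A j t) = 0).
Proof.
have rhoV_gt0 : 0 < rho^-1 by rewrite invr_gt0.
have momN := tau_semicircular rhoV_gt0 hS.
have stein_k : stein_kernel (quadratic_potential n rho) X (A k).
  by apply: hA; rewrite hk leqnn.
have momX := word_moments hrho (fun i w => schwinger_dyson hX i stein_k).
split=> [P Pk|mom_top j jk t].
  rewrite /nceval /linext !raddf_sum /=; apply: eq_big_seq => w wP.
  rewrite !linearZ /= -[w]fmK -(revK w) momN momX // size_rev.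
  by apply: leq_trans Pk; exact: leq_bigmax_seq.
have momX1 w : (size w <= k.+1)%N ->
    tau M (word_eval X (FMonom (rev w))) = vacuum_coef (rho^-1)%:C%C w [::].
  rewrite leq_eqVlt => /predU1P [wk|]; last by rewrite ltnS; exact: momX.
  rewrite -momN -!nceval_basis mom_top // /ncdeg msuppU oner_eq0 big_seq_fset1.
  by rewrite size_rev.
(* The mean of the entry t is the defect of a Schwinger-Dyson equation whose
   words have length at most j + 1, hence at most k + 1. *)
have [_ j_le_k] := andP jk.
rewrite (stein_kernel_mean hX t (hA j jk)) momX1 ?size_tuple //.
rewrite {1}(tuple_eta t) vacuum_coef_cons mulrA.
rewrite -rmorphM /= mulfV ?gt_eqF // rmorph1 mul1r.
apply/eqP; rewrite subr_eq0; apply/eqP.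
rewrite !big_seq; apply: eq_bigr => s ts.
have lt_k (x : nat) : (x < size (behead t))%N -> (x <= k.+1)%N.
  rewrite size_behead size_tuple /= => xj.
  exact: leq_trans (ltnW xj) (leq_trans j_le_k (leqnSn k)).
rewrite !momX1 //; apply: lt_k; first exact: splits_size2 ts.
exact: splits_size1 ts.
Qed.
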